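(* Let $\Delta$ be a distance set. Then every unitary representation of $\mathrm{Isom}(\mathbb{U}_\Delta)$ is dissociated.
   Context: A distance set is either a countable additive subsemigroup of the non-negative reals containing $0$, or the intersection $\mathcal{S}\cap[0,r]$ of such a semigroup $\mathcal{S}$ with a bounded interval $[0,r]$, where $r\in\mathcal{S}$. A $\Delta$-metric space is a metric space whose metric takes values in $\Delta$. The Urysohn $\Delta$-metric space $\mathbb{U}_\Delta$ is the unique (up to isometry) countable $\Delta$-metric space which is ultrahomogeneous (every isometry between finite subsets extends to an isometry of $\mathbb{U}_\Delta$ onto itself) and universal (every countable $\Delta$-metric space embeds isometrically into $\mathbb{U}_\Delta$). $\mathrm{Isom}(\mathbb{U}_\Delta)$ is the group of isometries of $\mathbb{U}_\Delta$ onto itself, with the Polish topology of pointwise convergence, $\mathbb{U}_\Delta$ being viewed as a discrete topological space; it is regarded as a permutation group on $\Omega=\mathbb{U}_\Delta$. Unitary representations are homomorphisms into the unitary group of a complex Hilbert space (which may be assumed separable), continuous for the strong operator topology. For a group $G$ of permutations of $\Omega$, a unitary representation $\pi\colon G\to\mathcal{U}(\mathcal{H})$ and $A\subseteq\Omega$ finite, let $G_A=\{g\in G: g(a)=a\ \forall a\in A\}$ and let $\mathcal{H}_A$ be the subspace of $G_A$-invariant vectors. For closed subspaces with $\mathcal{H}_2\subseteq\mathcal{H}_1\cap\mathcal{H}_3$, $\mathcal{H}_1$ and $\mathcal{H}_3$ are orthogonal conditionally on $\mathcal{H}_2$ if $\mathcal{H}_1\cap\mathcal{H}_2^\perp$ and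 $\mathcal{H}_3\cap\mathcal{H}_2^\perp$ are orthogonal. $\pi$ is dissociated if for all finite $A,B\subseteq\Omega$, $\mathcal{H}_A$ and $\mathcal{H}_B$ are orthogonal conditionally on $\mathcal{H}_{A\cap B}$. *)

(* Defs.v *)
From HB Require Import structures.
From mathcomp Require Import all_boot all_order all_algebra.
From mathcomp Require Import complex.
From mathcomp Require Import all_classical all_reals all_analysis.

Set Implicit Arguments.
Unset Strict Implicit.
Unset Printing Implicit Defensive.

Import Order.TTheory GRing.Theory Num.Theory Num.Def.
Import numFieldNormedType.Exports.

Local Open Scope classical_set_scope.
Local Open Scope ring_scope.

Section DistanceSets.
Variable R : realType.

Definition distance_semigroup (S : set R) : Prop :=
  [/\ countable S, S `<=` [set x | 0 <= x], S 0
    & forall x y, S x -> S y -> S (x + y)].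

Definition distance_set (D : set R) : Prop :=
  distance_semigroup D \/
  exists S r, [/\ distance_semigroup S, S r & D = S `&` `[0, r]].

End DistanceSets.

Section UrysohnSpaces.
Variable R : realType.

Definition isometric (X Y : metricType R) (f : X -> Y) : Prop :=
  forall x y, mdist (f x) (f y) = mdist x y.

Definition isometric_on (X Y : metricType R) (A : set X) (f : X -> Y) : Prop :=
  forall x y, A x -> A y -> mdist (f x) (f y) = mdist x y.

Definition valued_in (D : set R) (X : metricType R) : Prop :=
  forall x y : X, D (mdist x y).

End UrysohnSpaces.

Section IsometryGroup.
Context {R : realType} (X : metricType R).

Record Isom : Type := MkIsom {
  isom_fun :> X -> X;
  isom_isometric : isometric isom_fun;
  isom_surj : forall y, exists x, isom_fun x = y
}.

HB.instance Definition _ := gen_eqMixin Isom.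
HB.instance Definition _ := gen_choiceMixin Isom.

Lemma isomP (g h : Isom) : g =1 h -> g = h.
Proof.
case: g => g g1 g2; case: h => h h1 h2 /= /funext gh.
by subst h; congr MkIsom; exact: Prop_irrelevance.
Qed.

Definition isom_one : Isom.
Proof. by exists id => // y; exists y. Defined.

Definition isom_mul (g h : Isom) : Isom.
Proof.
exists (g \o h) => [x y /=|y]; first by rewrite !isom_isometric.
have [x <-] := isom_surj g y; have [z <-] := isom_surj h x.
by exists z.
Defined.

Definition isom_inv_fun (g : Isom) (y : X) : X := projT1 (cid (isom_surj g y)).

Lemma isom_inv_funK (g : Isom) : cancel (isom_inv_fun g) g.
Proof. by move=> y; rewrite /isom_inv_fun; case: cid. Qed.

Lemma isom_inj (g : Isom) : injective g.
Proof.
by move=> x y gxy; apply: mdist_positivity; rewrite -(isom_isometric g) gxy mdistxx.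
Qed.

Definition isom_inv (g : Isom) : Isom.
Proof.
exists (isom_inv_fun g) => [x y|y].
  by rewrite -(isom_isometric g) !isom_inv_funK.
by exists (g y); apply: (@isom_inj g); rewrite isom_inv_funK.
Defined.

Lemma isom_mulA : associative isom_mul.
Proof. by move=> f g h; exact: isomP. Qed.
Lemma isom_mul1x : left_id isom_one isom_mul.
Proof. by move=> f; exact: isomP. Qed.
Lemma isom_mulx1 : right_id isom_one isom_mul.
Proof. by move=> f; exact: isomP. Qed.
Lemma isom_mulxV : right_inverse isom_one isom_inv isom_mul.
Proof. by move=> f; apply: isomP => x /=; rewrite isom_inv_funK. Qed.
Lemma isom_mulVx : left_inverse isom_one isom_inv isom_mul.
Proof.
by move=> f; apply: isomP => x /=; apply: (@isom_inj f); rewrite isom_inv_funK.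
Qed.

HB.instance Definition _ :=
  isGroup.Build Isom isom_mulA isom_mul1x isom_mulx1 isom_mulVx isom_mulxV.

(* Pointwise convergence with X viewed as a discrete space, not with its metric
   topology. *)
Definition isom_ptws (g : Isom) : {ptws X -> discrete_topology X} := g.

HB.instance Definition _ := Topological.copy Isom (initial_topology isom_ptws).

End IsometryGroup.

Section Urysohn.
Context {R : realType}.

Definition ultrahomogeneous (U : metricType R) : Prop :=
  forall (A : set U) (f : U -> U), finite_set A -> isometric_on A f ->
  exists g : Isom U, forall a, A a -> g a = f a.

Definition universal_for (D : set R) (U : metricType R) : Prop :=
  forall X : metricType R, countable [set: X] -> valued_in D X ->
  exists f : X -> U, isometric f.

Definition is_urysohn (D : set R) (U : metricType R) : Prop :=
  [/\ countable [set: U], valued_in D U, ultrahomogeneous U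
    & universal_for D U].

End Urysohn.

HB.mixin Record CompleteNormedModule_isHilbert (R : realType) H
    of CompleteNormedModule R[i] H := {
  inner : {dot H for (@conjC R[i])};
  norm_innerE : forall x : H, `|x| ^+ 2 = inner x x
}.

#[short(type="hilbertType")]
HB.structure Definition Hilbert (R : realType) :=
  {H of CompleteNormedModule R[i] H & CompleteNormedModule_isHilbert R H}.

Section UnitaryGroup.
Context {R : realType} (H : hilbertType R).

Record unitary : Type := Unitary {
  unitary_fun :> H -> H;
  unitary_linear : linear unitary_fun;
  unitary_inner : forall u v : H,
    inner (unitary_fun u) (unitary_fun v) = inner u v;
  unitary_surj : forall v, exists u, unitary_fun u = v
}.

HB.instance Definition _ := gen_eqMixin unitary.
HB.instance Definition _ := gen_choiceMixin unitary.

Lemma unitaryP (S T : unitary) : S =1 T -> S = T.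
Proof.
case: S => S S1 S2 S3; case: T => T T1 T2 T3 /= /funext ST.
by subst T; congr Unitary; exact: Prop_irrelevance.
Qed.

Lemma unitary_norm (T : unitary) (u : H) : `|T u| = `|u|.
Proof. by apply/(@pexpIrn _ 2); rewrite ?nnegrE// !norm_innerE unitary_inner. Qed.

Lemma unitary_inj (T : unitary) : injective T.
Proof.
move=> u v Tuv; apply/eqP; rewrite -subr_eq0 -normr_eq0 -(unitary_norm T).
have -> : T (u - v) = 0 by rewrite addrC -scaleN1r unitary_linear scaleN1r Tuv addNr.
by rewrite normr0.
Qed.

Definition unitary_one : unitary.
Proof. by exists id => // v; exists v. Defined.

Definition unitary_mul (S T : unitary) : unitary.
Proof.
exists (S \o T) => [a u v|u v|v] /=.
- by rewrite !unitary_linear.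
- by rewrite !unitary_inner.
- have [w <-] := unitary_surj S v; have [x <-] := unitary_surj T w.
  by exists x.
Defined.

Definition unitary_inv_fun (T : unitary) (v : H) : H :=
  projT1 (cid (unitary_surj T v)).

Lemma unitary_inv_funK (T : unitary) : cancel (unitary_inv_fun T) T.
Proof. by move=> v; rewrite /unitary_inv_fun; case: cid. Qed.

Definition unitary_inv (T : unitary) : unitary.
Proof.
exists (unitary_inv_fun T) => [a u v|u v|v].
- by apply: (@unitary_inj T); rewrite unitary_linear !unitary_inv_funK.
- by rewrite -(unitary_inner T) !unitary_inv_funK.
- by exists (T v); apply: (@unitary_inj T); rewrite unitary_inv_funK.
Defined.

Lemma unitary_mulA : associative unitary_mul.
Proof. by move=> S T U; exact: unitaryP. Qed.
Lemma unitary_mul1x : left_id unitary_one unitary_mul.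
Proof. by move=> T; exact: unitaryP. Qed.
Lemma unitary_mulx1 : right_id unitary_one unitary_mul.
Proof. by move=> T; exact: unitaryP. Qed.
Lemma unitary_mulxV : right_inverse unitary_one unitary_inv unitary_mul.
Proof. by move=> T; apply: unitaryP => v /=; rewrite unitary_inv_funK. Qed.
Lemma unitary_mulVx : left_inverse unitary_one unitary_inv unitary_mul.
Proof.
move=> T; apply: unitaryP => v /=.
by apply: (@unitary_inj T); rewrite unitary_inv_funK.
Qed.

HB.instance Definition _ := isGroup.Build unitary
  unitary_mulA unitary_mul1x unitary_mulx1 unitary_mulVx unitary_mulxV.

(* Strong operator topology: pointwise convergence for the norm topology. *)
Definition unitary_ptws (T : unitary) : {ptws H -> H} := T.

HB.instance Definition _ :=
  Topological.copy unitary (initial_topology unitary_ptws).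

End UnitaryGroup.

Section Dissociation.
Context {R : realType} (H : hilbertType R).

Definition orthogonal_sets (V W : set H) : Prop :=
  forall v w, V v -> W w -> inner v w = 0.

Definition ortho_compl (V : set H) : set H :=
  [set w | forall v, V v -> inner v w = 0].

Definition cond_orthogonal (H1 H3 H2 : set H) : Prop :=
  orthogonal_sets (H1 `&` ortho_compl H2) (H3 `&` ortho_compl H2).

Context (G : groupType) (Omega : Type) (act : G -> Omega -> Omega).
Context (pi : {multiplicative G -> unitary H}).

Definition fixator (A : set Omega) : set G :=
  [set g | forall a, A a -> act g a = a].

Definition invariant_vectors (A : set Omega) : set H :=
  [set v | forall g, fixator A g -> pi g v = v].

Definition dissociated : Prop :=
  forall A B : set Omega, finite_set A -> finite_set B ->
  cond_orthogonal (invariant_vectors A) (invariant_vectors B)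
    (invariant_vectors (A `&` B)).

End Dissociation.

(* Main.v *)
From HB Require Import structures.
Require Import Defs.
From mathcomp Require Import all_boot all_order all_algebra.
From mathcomp Require Import complex.
From mathcomp Require Import all_classical all_reals all_analysis.
From mathcomp Require Import ring lra.

(** Vectors fixed by the stabiliser of A can be peeled one point at a time, so
    the heart of the matter is the following ([peel_point]): if C is contained
    in B, a is a point outside B, and v is fixed by the stabiliser of C + a,
    then there is a vector u fixed by the stabiliser of C that has the same
    inner product as v with every vector w fixed by the stabiliser of B.
    Repeating this until A is reduced to its intersection with B turns v into
    some u fixed by the stabiliser of that intersection.  If w is fixed by the
    stabiliser of B and orthogonal to all such u, it is orthogonal to v.

    Write v_x for the vector pi(g) v, where g fixes C pointwise and g a = x;
    it depends only on the point x of the orbit of a, and by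
    ultrahomogeneity the inner product of v_x and v_y depends only on the
    distance of x and y.  Choose d > 0 in Delta below all the distances from
    a to B.  The extension property of U then yields infinitely many points
    x_0, x_1, ... at mutual distance d and at the same distances as a from
    the points of B.  The Gram matrix of the vectors v_{x_i} has one value c
    off the diagonal and one value on it, hence their averages converge to
    some u ([average_limit]).  As x_i is the image of a under an isometry
    fixing B, all v_{x_i} have the same inner product as v with w, and so
    does u.

    It remains to see that u is fixed by the stabiliser of C, for which it is
    enough that u has inner product c with v_y for every y in the orbit.  Let
    s be a distance at which inner products equal c, and suppose that points
    p_i at mutual distance d can be found at distance s from all the x_j and
    from y.  The vectors v_{x_i} - v_{p_i} are then orthogonal of equal norm,
    so by the Cauchy-Schwarz inequality their averages, hence their inner
    products with v_y, tend to 0; since the inner product of v_{p_i} and v_y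
    is c, the averages of those of v_{x_i} and v_y tend to c
    ([clique_average_bound]).  Such p_i exist as soon as the distances from
    y to the x_j are at most 2s.  If all of them equal one number t, this
    shows that inner products at distance t equal c too; starting from
    distance d, where this holds by definition of c, and doubling, every
    distance at least d that occurs in the orbit is reached
    ([constant_at_all]).  So for any y and any finite number of the x_j, one
    may take for s the largest of d and of the distances from y to these
    x_j. *)

Set Implicit Arguments.
Unset Strict Implicit.
Unset Printing Implicit Defensive.
Import Order.TTheory GRing.Theory Num.Theory.
Import numFieldNormedType.Exports.

Local Open Scope classical_set_scope.
Local Open Scope ring_scope.

(** * Averages of vectors with a two-valued Gram matrix *)

Lemma archi_complex (R : realType) (x e : R[i]) : 0 <= x -> 0 < e ->
  exists N, x < N.+1%:R * e.
Proof.
move=> x0 e0; have r0 : 0 <= x / e by rewrite divr_ge0// ltW.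
exists (Num.bound (complex.Re (x / e))).
rewrite -ltr_pdivrMr// -[x / e]RRe_real ?ger0_real//.
rewrite -(rmorph_nat (real_complex R)) ltcR.
apply: (lt_trans (archi_boundP _)); last by rewrite ltr_nat.
by move: r0; rewrite lecE => /andP[].
Qed.

Section Hilbert.
Context {R : realType} {H : hilbertType R}.
Implicit Types u v w z : H.
Local Notation "'[ u , v ]" := (@inner R H u v).

Lemma innerC u v : '[u, v] = ('[v, u])^*.
Proof. by rewrite hermC expr0 mul1r. Qed.

Lemma innerZl a u v : '[a *: u, v] = a * '[u, v].
Proof. by rewrite linearZl_LR. Qed.

Lemma innerZr a u v : '[u, a *: v] = a^* * '[u, v].
Proof. by rewrite linearZr_LR. Qed.

Lemma cauchy_schwarz u v : `|'[u, v]| ^+ 2 <= '[u, u] * '[v, v].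
Proof.
have [->|v0] := eqVneq v 0; first by rewrite !linear0r normr0 expr0n.
have V0 : 0 < '[v, v] by rewrite dnorm_gt0.
have := dnorm_ge0 (@inner R H) (u - ('[u, v] / '[v, v]) *: v).
rewrite dnormB innerZl !innerZr.
set p := '[u, v]; set V := '[v, v] in V0 *; set t := p / V.
have Vr : V^* = V by rewrite geC0_conj ?ltW.
have Vn0 : V != 0 by rewrite gt_eqF.
have -> : t * (t^* * V) = `|p| ^+ 2 / V.
  by rewrite normCK /t rmorphM/= fmorphV/= Vr; field.
have -> : t^* * p = `|p| ^+ 2 / V.
  by rewrite normCK /t rmorphM/= fmorphV/= Vr; field.
rewrite [X in _ - (_ + X)]geC0_conj; last first.
  by rewrite divr_ge0 ?exprn_ge0 ?(ltW V0)//.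
by rewrite opprD addrA addrK subr_ge0 ler_pdivrMr.
Qed.

(** The differences X i - P i are orthogonal of equal squared norm 2k, so the
    squared norm of their sum grows only linearly in N, while the left-hand
    side is quadratic in N. *)
Lemma orthogonal_sum_bound (X P : nat -> H) (z : H) c k N :
  (forall i j, (i < N)%N -> (j < N)%N ->
     '[X i, X j] = c + (i == j)%:R * k) ->
  (forall i j, (i < N)%N -> (j < N)%N ->
     '[P i, P j] = c + (i == j)%:R * k) ->
  (forall i j, (i < N)%N -> (j < N)%N -> '[X i, P j] = c) ->
  (forall i, (i < N)%N -> '[P i, z] = c) -> c^* = c ->
  `|'[\sum_(i < N) X i, z] - N%:R * c| ^+ 2 <= N%:R * (2 * k * '[z, z]).
Proof.
move=> XX PP XP Pz cr.
have -> : '[\sum_(i < N) X i, z] - N%:R * c =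
    '[\sum_(i < N) (X i - P i), z].
  rewrite sumrB linearBl/= [X in _ = _ - X]linear_sumlz /=.
  rewrite (eq_bigr (fun=> c)) => [|i _]; last exact: Pz.
  by rewrite sumr_const card_ord mulr_natl.
apply: (le_trans (cauchy_schwarz _ _)); rewrite mulrA ler_wpM2r ?dnorm_ge0//.
have e i j : (i < N)%N -> (j < N)%N ->
    '[X i - P i, X j - P j] = (i == j)%:R * (2 * k).
  move=> iN jN; rewrite linearBl/= !linearBr/= XX// PP// XP// innerC XP// cr.
  by ring.
rewrite linear_sumlz/= (eq_bigr (fun=> 2 * k)) => [|i _].
  by rewrite sumr_const card_ord -[leLHS]mulr_natl.
rewrite linear_sumr/= (bigD1 i)//= e// eqxx mul1r big1 ?addr0// => j ji.
by rewrite e// val_eqE eq_sym (negPf ji) mul0r.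
Qed.

Lemma inner_partial_sums (X : nat -> H) c k N M :
  (forall i j, '[X i, X j] = c + (i == j)%:R * k) -> (N <= M)%N ->
  '[\sum_(i < N) X i, \sum_(i < M) X i] = N%:R * (M%:R * c + k).
Proof.
move=> XX NM; rewrite linear_sumlz/= (eq_bigr (fun=> M%:R * c + k)) => [|i _].
  by rewrite sumr_const card_ord -[LHS]mulr_natl.
rewrite linear_sumr/=; under eq_bigr do rewrite XX.
rewrite big_split/= sumr_const card_ord -[c *+ _]mulr_natl; congr (_ + _).
rewrite (bigD1 (widen_ord NM i))//= eqxx mul1r big1 ?addr0// => j.
by rewrite -val_eqE/= eq_sym => /negPf ->; rewrite mul0r.
Qed.

Lemma normr_inner u v : `|'[u, v]| <= `|u| * `|v|.
Proof.
rewrite -(@ler_pXn2r _ 2) ?nnegrE ?mulr_ge0//.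
by rewrite exprMn !norm_innerE cauchy_schwarz.
Qed.

(** The averages form a Cauchy sequence: the squared distance of the averages
    of the first N and the first M terms is k(1/N - 1/M) for N <= M.  The
    bound in K, once divided by N^2, says that the inner products of the
    averages with z converge to d at rate 1/N. *)
Lemma average_limit (X : nat -> H) c k :
  (forall i j, '[X i, X j] = c + (i == j)%:R * k) ->
  exists u, forall (z : H) (d K : R[i]),
    (forall N, `|'[\sum_(i < N) X i, z] - N%:R * d| ^+ 2 <= N%:R * K) ->
    '[u, z] = d.
Proof.
move=> XX.
pose a N := (N.+1%:R^-1 : R[i]) *: \sum_(i < N.+1) X i.
have k0 : 0 <= k.
  have := dnorm_ge0 (@inner R H) (X 0%N - X 1%N).
  rewrite linearBl/= !linearBr/= !XX/= => h.
  suff : 0 <= 2 * k by rewrite pmulr_rge0.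
  by move: h; congr (_ <= _); ring.
have cr : c^* = c by have := XX 0%N 1%N; rewrite innerC XX/= !mul0r !addr0.
have kr : k^* = k by rewrite geC0_conj.
have dist N M : (N <= M)%N -> `|a N - a M| ^+ 2 <= k / N.+1%:R.
  move=> NM; have NM' : (N.+1 <= M.+1)%N by [].
  have MN : '[\sum_(i < M.+1) X i, \sum_(i < N.+1) X i] =
      N.+1%:R * (M.+1%:R * c + k).
    rewrite innerC (inner_partial_sums XX NM').
    by rewrite !(rmorphM, rmorphD)/= !conjC_nat cr kr.
  rewrite norm_innerE linearBl/= !linearBr/= !innerZl !innerZr.
  rewrite !(inner_partial_sums XX (leqnn _)) (inner_partial_sums XX NM') MN.
  rewrite !fmorphV/= !conjC_nat.
  have N0 : N.+1%:R != 0 :> R[i] by rewrite pnatr_eq0.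
  have M0 : M.+1%:R != 0 :> R[i] by rewrite pnatr_eq0.
  rewrite -subr_ge0; have /le_trans->// : 0 <= k / M.+1%:R by rewrite divr_ge0.
  rewrite le_eqVlt; apply/orP; left; apply/eqP.
  by field; rewrite !nat1r M0 N0.
have : cauchy (a @ \oo).
  apply: cauchy_exP => e e0.
  have [N kN] := archi_complex k0 (exprn_gt0 2 e0).
  exists (a N); exists N => // M /= NM.
  rewrite -ball_normE/=.
  rewrite -(@ltr_pXn2r _ 2) ?nnegrE ?(ltW e0)//.
  by apply: le_lt_trans (dist _ _ NM) _; rewrite ltr_pdivrMr// mulrC.
move=> /cauchy_cvg/cvg_ex[u au]; exists u => z d K dK.
apply/eqP; rewrite -subr_eq0; apply/negPn/negP; rewrite -normr_gt0.
set D := `|_| => D0.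
have D2 : 0 < D / 2 by rewrite divr_gt0.
have K0 : 0 <= K.
  by have := dK 1%N; rewrite !mul1r; apply: le_trans; rewrite exprn_ge0.
have [N0 KN0] := archi_complex K0 (exprn_gt0 2 D2).
have z0 : 0 < `|z| + 1 by rewrite ltr_wpDl.
have /cvgrPdist_lt/(_ _ (divr_gt0 D2 z0)) [N1 _ uN1] := au.
pose N := maxn N0 N1.
have uN : `|'[u - a N, z]| < D / 2.
  apply: le_lt_trans (normr_inner _ _) _.
  have := uN1 N (leq_maxr _ _); rewrite ltr_pdivlMr//; apply: le_lt_trans.
  by rewrite ler_wpM2l// lerDl.
have aN : `|'[a N, z] - d| < D / 2.
  rewrite -(@ltr_pXn2r _ 2) ?nnegrE ?(ltW D2)//.
  have -> : '[a N, z] - d =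
      N.+1%:R^-1 * ('[\sum_(i < N.+1) X i, z] - N.+1%:R * d).
    by rewrite innerZl mulrBr mulKf// pnatr_eq0.
  rewrite normrM exprMn normfV normr_nat.
  apply: (@le_lt_trans _ _ (N.+1%:R ^- 2 * (N.+1%:R * K))).
    by rewrite exprVn ler_wpM2l// invr_ge0 exprn_ge0.
  have -> : N.+1%:R ^- 2 * (N.+1%:R * K) = K / N.+1%:R :> R[i].
    by field; rewrite nat1r pnatr_eq0.
  rewrite ltr_pdivrMr// mulrC; apply: lt_le_trans KN0 _.
  by rewrite ler_wpM2r ?exprn_ge0 ?(ltW D2)// ler_nat ltnS leq_maxl.
have : D < D.
  rewrite [ltRHS]splitr; apply: le_lt_trans (ltrD uN aN).
  by apply: le_trans (ler_normD _ _); rewrite linearBl/= addrA subrK.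
by rewrite ltxx.
Qed.
End Hilbert.

(** * Extending finite subsets of a Urysohn space by infinite cliques *)

Section Extension.
Context {R : realType} (Delta : set R) (U : metricType R).
Hypothesis Delta0 : Delta 0.
Hypothesis uryU : is_urysohn Delta U.

(** The one-point amalgam of E with the distances h, with its new point
    repeated infinitely often at mutual distance delta. *)
Definition cone_dist (E : set U) (h : U -> R) (delta : R) (x y : E + nat) : R :=
  match x, y with
  | inl a, inl b => mdist (val a) (val b)
  | inl a, inr _ => h (val a)
  | inr _, inl b => h (val b)
  | inr i, inr j => if i == j then 0 else delta
  end.

(** The triangle inequality for [cone_dist] is exactly what the hypotheses on
    h and delta ensure.  Universality embeds this countable space in U, and
    ultrahomogeneity moves the image of E back onto E. *)
Lemma urysohn_extension (E : set U) (h : U -> R) (delta : R) :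
  finite_set E -> Delta delta -> 0 < delta ->
  (forall x, E x -> [/\ Delta (h x), 0 < h x & delta <= 2 * h x]) ->
  (forall x y, E x -> E y -> h x <= mdist x y + h y) ->
  (forall x y, E x -> E y -> mdist x y <= h x + h y) ->
  exists p : nat -> U,
    (forall i x, E x -> mdist (p i) x = h x) /\
    (forall i j, i != j -> mdist (p i) (p j) = delta).
Proof.
move=> finE Dd d0 hE hlip hdiam.
have [countU valU homU univU] := uryU.
pose d := @cone_dist E h delta.
have dxx x : d x x = 0.
  by case: x => [a|i] /=; rewrite /d /= ?mdistxx ?eqxx.
have dpos x y : d x y = 0 -> x = y.
  case: x y => [a|i] [b|j]; rewrite /d /=.
  - by move/mdist_positivity/val_inj => ->.
  - by have [_ + _] := hE _ (set_valP a) => /[swap] ->; rewrite ltxx.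
  - by have [_ + _] := hE _ (set_valP b) => /[swap] ->; rewrite ltxx.
  - by case: eqP => [->//|_] d00; move: d0; rewrite d00 ltxx.
have dsym x y : d x y = d y x.
  by case: x y => [a|i] [b|j]; rewrite /d //= 1?eq_sym//;
    exact: metric_sym.
have dtri y x z : d x z <= d x y + d y z.
  case: x y z => [a|i] [b|j] [c|k]; rewrite /d /=.
  - exact: metric_triangle.
  - exact: (hlip _ _ (set_valP _) (set_valP _)).
  - exact: (hdiam _ _ (set_valP _) (set_valP _)).
  - by have [_ ? _] := hE _ (set_valP a); case: eqP => _; lra.
  - by rewrite metric_sym addrC (hlip _ _ (set_valP _) (set_valP _)).
  - by have [_ ? ?] := hE _ (set_valP b); case: eqP => _; lra.
  - by have [_ ? _] := hE _ (set_valP c); case: eqP => _; lra.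
  - have [->|ik] := eqVneq i k; first by do 2!case: ifP => _; lra.
    have [ij|_] := eqVneq i j; first by rewrite -ij (negPf ik); lra.
    by case: ifP => _; lra.
pose T := (E + nat)%type.
pose X : metricType R := HB.pack T (isMetric.Build R T dxx dpos dsym dtri).
have cX : countable [set: X].
  have /countable_injP[phi phiI] := countU.
  (* even numbers code the points of E, odd numbers the new points *)
  apply/countable_injP; exists (fun x : T =>
    match x with inl a => (phi (val a)).*2 | inr i => i.*2.+1 end).
  move=> [a|i] [b|j] _ _ /=.
  - by move/double_inj/(phiI _ _ (mem_set I) (mem_set I))/val_inj => ->.
  - by move/(congr1 odd); rewrite /= !odd_double.
  - by move/(congr1 odd); rewrite /= !odd_double.
  - by case=> /double_inj ->.
have vX : valued_in Delta X.
  move=> x y; change (Delta (d x y)).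
  case: x y => [a|i] [b|j]; rewrite /d /=.
  - exact: valU.
  - by have [] := hE _ (set_valP a).
  - by have [] := hE _ (set_valP b).
  - by case: eqP.
have [f fiso] := univU X cX vX.
pose F (x : U) : U :=
  if pselect (E x) is left Ex then f (inl (SigSub (mem_set Ex))) else x.
have FE (a : E) : F (val a) = f (inl a).
  rewrite /F; case: pselect => [Ex|]; last by case; exact: set_valP.
  by congr (f (inl _)); apply: val_inj.
have Fiso : isometric_on E F.
  move=> x y Ex Ey.
  rewrite -[x](erefl : val (SigSub (mem_set Ex)) = x).
  rewrite -[y](erefl : val (SigSub (mem_set Ey)) = y).
  by rewrite !FE fiso.
have [g gF] := homU E F finE Fiso.
exists (fun i => isom_inv g (f (inr i))); split.
  move=> i x Ex; rewrite -(isom_isometric g) isom_inv_funK gF//.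
  rewrite -[x](erefl : val (SigSub (mem_set Ex)) = x) FE.
  exact: fiso.
move=> i j ij; rewrite isom_isometric fiso.
by change ((if i == j then 0 else delta) = delta); rewrite (negPf ij).
Qed.
End Extension.

(** * Distance sets *)

Lemma distance_set0 (R : realType) (Delta : set R) :
  distance_set Delta -> Delta 0.
Proof.
case=> [[_ _]//|[S [r [[_ S0 S00 _] Sr ->]]]].
by split => //=; rewrite in_itv/= lexx S0.
Qed.

(** The bound by an element of Delta matters when Delta is truncated: it keeps
    the multiple inside the interval. *)
Lemma distance_set_natmul (R : realType) (Delta : set R) (d t : R) (m : nat) :
  distance_set Delta -> Delta d -> Delta t -> m%:R * d <= t -> Delta (m%:R * d).
Proof.
move=> DD Dd Dt.
have mulS S : distance_semigroup S -> S d -> S (m%:R * d).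
  move=> [_ _ S0 SD] Sd; elim: m => [|m IH]; first by rewrite mul0r.
  by rewrite -natr1 mulrDl mul1r; exact: SD.
case: DD => [hS _|[S [r [hS Sr eD]]]]; first exact: mulS.
move: Dd Dt; rewrite eD => -[Sd /=]; rewrite in_itv/= => /andP[d0 _].
move=> [_ /=]; rewrite in_itv/= => /andP[_ tr] mt.
split; first exact: mulS.
by rewrite /= in_itv/= mulr_ge0//= (le_trans mt).
Qed.

(** * Pointwise stabilisers *)

Section Isometries.
Context {R : realType} (U : metricType R).
Implicit Types (A B C E : set U) (a x y z : U) (g h k : Isom U).
Local Notation fix_ := (fixator (@isom_fun R U)).

Lemma fixator_mul A g h : fix_ A g -> fix_ A h -> fix_ A (g * h)%g.
Proof. by move=> gA hA x Ax; change (g (h x) = x); rewrite hA// gA. Qed.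

Lemma fixator_inv A g : fix_ A g -> fix_ A (g^-1)%g.
Proof.
move=> gA x Ax; apply: (@isom_inj _ _ g).
by rewrite (gA x Ax); exact: isom_inv_funK.
Qed.

Lemma fixatorS A B g : A `<=` B -> fix_ B g -> fix_ A g.
Proof. by move=> AB gB x /AB/gB. Qed.

Lemma fixator_dist A g x y : fix_ A g -> A y -> mdist (g x) y = mdist x y.
Proof. by move=> gA Ay; rewrite -{1}(gA _ Ay) isom_isometric. Qed.

(** Ultrahomogeneity applied to the map fixing E and sending x to y. *)
Lemma transport E x y : ultrahomogeneous U -> finite_set E ->
  (forall e, E e -> mdist y e = mdist x e) -> exists2 g, fix_ E g & g x = y.
Proof.
move=> homU finE xy.
pose f z := if z == x then y else z.
have fE z : E z -> f z = z.
  move=> Ez; rewrite /f; case: eqP => // zx.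
  by apply: mdist_positivity; rewrite xy// zx mdistxx.
have fx : f x = y by rewrite /f eqxx.
have finEx : finite_set (x |` E) by rewrite finite_setU; split.
have [|g gf] := homU _ f finEx.
  move=> u w [->|Eu] [->|Ew]; rewrite ?fx ?fE ?mdistxx ?xy//.
  by rewrite metric_sym xy// metric_sym.
exists g; last by rewrite gf//; left.
by move=> e Ee; rewrite gf ?fE//; right.
Qed.

End Isometries.

(** * Unitary representations and orbits of a point *)

Section Representation.
Context {R : realType} (U : metricType R) (H : hilbertType R).
Context (pi : {multiplicative Isom U -> unitary H}).
Implicit Types (A B C E : set U) (a x y z : U) (g h k : Isom U).
Local Notation fix_ := (fixator (@isom_fun R U)).
Local Notation inv_ := (invariant_vectors (@isom_fun R U) pi).
Local Notation "'[ u , v ]" := (@inner R H u v).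

Lemma repM g h v : pi (g * h)%g v = pi g (pi h v).
Proof. by rewrite gmulfM. Qed.

Lemma rep1 v : pi 1%g v = v.
Proof. by apply: (@unitary_inj _ _ (pi 1%g)); rewrite -repM mulg1. Qed.

Lemma repVK g v : pi (g^-1)%g (pi g v) = v.
Proof. by rewrite -repM mulVg rep1. Qed.

Lemma rep_inner g v w : '[pi g v, w] = '[v, pi (g^-1)%g w].
Proof. by rewrite -(unitary_inner (pi (g^-1)%g)) repVK. Qed.

Section OnePoint.
Variables (Delta : set R) (C : set U) (a : U) (v : H) (delta : R).
Hypotheses (DD : distance_set Delta) (uryU : is_urysohn Delta U).
Hypotheses (finC : finite_set C) (vinv : inv_ (a |` C) v).
Hypotheses (Ddelta : Delta delta) (delta0 : 0 < delta).
Hypothesis deltaC : forall c, C c -> delta <= mdist a c.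

Let homU : ultrahomogeneous U. Proof. by case: uryU. Qed.
Let valU : valued_in Delta U. Proof. by case: uryU. Qed.

(** Equal distances give an isometry m fixing C and a that sends g a to g' a;
    then g' and m g differ by an element of the stabiliser of C + a, which
    fixes v. *)
Lemma inner_orbit1 g g' : fix_ C g -> fix_ C g' ->
  mdist a (g a) = mdist a (g' a) -> '[v, pi g v] = '[v, pi g' v].
Proof.
move=> gC g'C dgg'.
have [||m mC mg] := @transport _ _ (a |` C) (g a) (g' a) homU.
- by rewrite finite_setU; split.
- move=> e [->|Ce]; first by rewrite !(metric_sym _ a) dgg'.
  by rewrite !(fixator_dist _ _ Ce).
have mv : pi m v = v by exact: vinv.
have e : pi (g'^-1 * (m * g))%g v = v.
  apply: vinv => x [->|Cx].
    change ((g'^-1)%g (m (g a)) = a); rewrite mg.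
    by apply: (@isom_inj _ _ g'); exact: isom_inv_funK.
  have mC' : fix_ C m by apply: fixatorS mC => ? ?; right.
  exact: (fixator_mul (fixator_inv g'C) (fixator_mul mC' gC)).
have -> : pi g' v = pi m (pi g v) by rewrite -[in LHS]e -!repM mulVKg.
by rewrite -{3}mv unitary_inner.
Qed.

Lemma inner_orbit g h g' h' : fix_ C g -> fix_ C h -> fix_ C g' -> fix_ C h' ->
  mdist (g a) (h a) = mdist (g' a) (h' a) ->
  '[pi g v, pi h v] = '[pi g' v, pi h' v].
Proof.
move=> gC hC g'C h'C dd; rewrite !rep_inner -!repM; apply: inner_orbit1.
- exact: fixator_mul (fixator_inv gC) hC.
- exact: fixator_mul (fixator_inv g'C) h'C.
- have e k l : k ((k^-1 * l)%g a) = l a.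
    by rewrite -[LHS]/((k * (k^-1 * l))%g a) mulVKg.
  by rewrite -(isom_isometric g) e -[RHS](isom_isometric g') e.
Qed.

Lemma orbit_dist_le g h c : fix_ C g -> fix_ C h -> C c ->
  mdist (g a) (h a) <= 2 * mdist a c.
Proof.
move=> gC hC Cc; apply: le_trans (metric_triangle _ c _) _.
by rewrite [mdist c _]metric_sym !(fixator_dist _ _ Cc)// mulr_natl mulr2n.
Qed.

(** A clique in the orbit of a at constant distance s from a finite part F of
    that orbit: the points of the clique are required to have the same
    distances as a to C, which [transport] turns into membership in the
    orbit. *)
Lemma orbit_extension (F : set U) (s : R) :
  finite_set F -> (forall x, F x -> exists2 g, fix_ C g & g a = x) ->
  Delta s -> delta <= s -> (forall c, C c -> s <= 2 * mdist a c) ->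
  (forall x y, F x -> F y -> mdist x y <= 2 * s) ->
  exists p : nat -> Isom U, [/\ forall i, fix_ C (p i),
    forall i x, F x -> mdist (p i a) x = s
    & forall i j, i != j -> mdist (p i a) (p j a) = delta].
Proof.
move=> finF FC Ds ds sC Fs.
pose h x := if pselect (C x) is left _ then mdist a x else s.
have hC x : C x -> h x = mdist a x by rewrite /h; case: pselect.
have FnC x : F x -> ~ C x.
  move=> /FC[g gC <-] Cga; have := deltaC Cga; rewrite -(fixator_dist a gC Cga).
  by rewrite mdistxx leNgt delta0.
have hF x : F x -> h x = s by move=> /FnC; rewrite /h; case: pselect.
have dFC x c : F x -> C c -> mdist x c = mdist a c.
  by move=> /FC[g gC <-]; exact: fixator_dist.
have s0 : 0 < s by exact: lt_le_trans ds.
have [||||p [ph pd]] := @urysohn_extension _ _ _ (distance_set0 DD) uryU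
    (C `|` F) h delta _ Ddelta delta0.
- by rewrite finite_setU; split.
- move=> x [Cx|Fx]; rewrite ?(hC _ Cx) ?hF//.
    have dx := deltaC Cx; split; [exact: valU|exact: lt_le_trans dx|].
    by have d0 := delta0; lra.
  by split => //; lra.
- move=> x y [Cx|Fx] [Cy|Fy]; rewrite ?(hC _ Cx) ?(hC _ Cy) ?hF//.
  + by rewrite addrC [mdist x y]metric_sym; exact: metric_triangle.
  + by rewrite [mdist x y]metric_sym dFC// lerDl ltW.
  + by rewrite dFC//; have := sC _ Cy; lra.
  + by rewrite lerDr mdist_ge0.
- move=> x y [Cx|Fx] [Cy|Fy]; rewrite ?(hC _ Cx) ?(hC _ Cy) ?hF//.
  + by rewrite [mdist a x]metric_sym; exact: metric_triangle.
  + by rewrite [mdist x y]metric_sym dFC// lerDl ltW.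
  + by rewrite dFC// lerDr ltW.
  + by have := Fs _ _ Fx Fy; lra.
have /choice[q qP] : forall i, exists g, fix_ C g /\ g a = p i.
  move=> i; have [|g gC ga] := @transport _ _ C a (p i) homU finC.
    by move=> e Ce; rewrite ph ?hC//; left.
  by exists g.
exists q; split.
- by move=> i; case: (qP i).
- by move=> i x Fx; have [_ ->] := qP i; rewrite ph ?hF//; right.
- by move=> i j ij; have [_ ->] := qP i; have [_ ->] := qP j; exact: pd.
Qed.

(** Points of the orbit of a are represented by isometries carrying a to them,
    which gives direct access to the corresponding translates of v. *)
Definition constant_at (c : R[i]) (t : R) : Prop :=
  forall g h, fix_ C g -> fix_ C h -> mdist (g a) (h a) = t ->
    '[pi g v, pi h v] = c.

Definition clique (x : nat -> Isom U) : Prop :=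
  (forall i, fix_ C (x i)) /\
  (forall i j, i != j -> mdist (x i a) (x j a) = delta).

Lemma clique_gram c (x : nat -> Isom U) i j : constant_at c delta -> clique x ->
  '[pi (x i) v, pi (x j) v] = c + (i == j)%:R * ('[v, v] - c).
Proof.
move=> cdelta [xC xd]; have [->|ij] := eqVneq i j.
  by rewrite unitary_inner mul1r addrC subrK.
by rewrite mul0r addr0; apply: cdelta => //; exact: xd.
Qed.

(** Compare the x i with another clique p all of whose points are at distance
    s from every x i and from z a. *)
Lemma clique_average_bound c s (x : nat -> Isom U) (z : Isom U) N :
  constant_at c delta -> constant_at c s -> c^* = c -> clique x -> fix_ C z ->
  Delta s -> delta <= s -> (forall e, C e -> s <= 2 * mdist a e) ->
  (forall i, (i < N)%N -> mdist (x i a) (z a) <= 2 * s) ->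
  `|'[\sum_(i < N) pi (x i) v, pi z v] - N%:R * c| ^+ 2 <=
    N%:R * (2 * ('[v, v] - c) * '[v, v]).
Proof.
move=> cdelta cs cr xcl zC Ds ds sC xz; have [xC xd] := xcl.
have s0 : 0 < s by exact: lt_le_trans ds.
pose F := z a |` [set x i a | i in `I_N].
have finF : finite_set F.
  by rewrite finite_setU; split => //; apply: finite_image; exact: finite_II.
have FC y : F y -> exists2 g, fix_ C g & g a = y.
  by move=> [->|[i _ <-]]; [exists z|exists (x i)].
have [|p [pC pF pd]] := orbit_extension finF FC Ds ds sC.
  move=> y w [->|[i iN <-]] [->|[j jN <-]].
  - by rewrite mdistxx; lra.
  - by rewrite metric_sym; exact: xz.
  - exact: xz.
  - have [->|ij] := eqVneq i j; first by rewrite mdistxx; lra.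
    by rewrite xd//; lra.
have pcl : clique p by [].
rewrite -[X in _ * (_ * X)](unitary_inner (pi z)).
apply: (@orthogonal_sum_bound _ _ (fun i => pi (x i) v) (fun i => pi (p i) v)).
- by move=> i j _ _; exact: clique_gram.
- by move=> i j _ _; exact: clique_gram.
- move=> i j iN _; apply: cs => //.
  by rewrite metric_sym pF//; right; exists i.
- by move=> i iN; apply: cs => //; rewrite pF//; left.
- by [].
Qed.

(** For two points at distance t, surround the second one by a clique at
    distance t.  The limit u of the averages over this clique has inner
    product c with the vector at the second point because t <= 2s, but this
    inner product is also the common one of all pairs at distance t. *)
Lemma constant_at_double c s t :
  constant_at c delta -> constant_at c s -> c^* = c ->
  Delta s -> delta <= s -> Delta t -> s <= t -> t <= 2 * s -> constant_at c t.
Proof.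
move=> cdelta cs cr Ds ds Dt st ts g h gC hC dgh.
have tC e : C e -> t <= 2 * mdist a e.
  by move=> Ce; rewrite -dgh; exact: orbit_dist_le.
have d0 := delta0.
have [||||||p [pC pF pd]] := @orbit_extension [set h a] t.
- exact: finite_set1.
- by move=> y ->; exists h.
- by [].
- exact: le_trans st.
- exact: tC.
- by move=> y w -> ->; rewrite mdistxx; lra.
have pcl : clique p by [].
have [u uP] := average_limit (fun i j => clique_gram i j cdelta pcl).
have <- : '[u, pi h v] = c.
  apply: uP => N; apply: (clique_average_bound cdelta cs cr pcl hC Ds ds).
    by move=> e Ce; exact: le_trans st (tC _ Ce).
  by move=> i _; rewrite pF.
apply/esym/(uP _ _ 0) => N.
rewrite linear_sumlz/= (eq_bigr (fun=> '[pi g v, pi h v])) => [|i _].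
  by rewrite sumr_const card_ord mulr_natl subrr normr0 expr0n mulr0.
by apply: inner_orbit => //; rewrite pF.
Qed.

Lemma constant_at_all c t : constant_at c delta -> c^* = c ->
  Delta t -> delta <= t -> constant_at c t.
Proof.
move=> cdelta cr Dt dt.
have [m tm] : exists m, t <= 2 ^+ m * delta.
  exists (Num.bound (t / delta)); rewrite -ler_pdivrMr//.
  by apply/ltW/upper_nthrootP.
elim: m t Dt dt tm => [|m IH] t Dt dt tm.
  suff -> : t = delta by [].
  by apply/eqP; rewrite eq_le dt andbT; move: tm; rewrite expr0 mul1r.
have [tm'|tm'] := leP t (2 ^+ m * delta); first exact: IH.
have Ds : Delta (2 ^+ m * delta).
  by move: (ltW tm'); rewrite -natrX; exact: distance_set_natmul.
have ds : delta <= 2 ^+ m * delta by rewrite ler_peMl ?exprn_ege1 ?ler1n ?ltW.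
apply: (constant_at_double cdelta (IH _ Ds ds (lexx _)) cr Ds ds Dt).
  exact: ltW.
by rewrite mulrA -exprS.
Qed.

(** The limit u of the averages has the same inner product with all translates
    of v.  So g u - u is orthogonal to all of them, hence to u, for every g
    fixing C, and this forces g u = u. *)
Lemma clique_average_fixed (x : nat -> Isom U) : clique x ->
  exists2 u, inv_ C u & forall (w : H) (d : R[i]),
    (forall i, '[pi (x i) v, w] = d) -> '[u, w] = d.
Proof.
move=> xcl; have [xC xd] := xcl.
pose c := '[pi (x 0%N) v, pi (x 1%N) v].
have cdelta : constant_at c delta.
  by move=> g h gC hC gh; apply: inner_orbit => //; rewrite gh xd.
have cr : c^* = c.
  by rewrite /c -innerC; apply: inner_orbit => //; rewrite metric_sym.
have [u uP] := average_limit (fun i j => clique_gram i j cdelta xcl).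
have uavg w d : (forall i, '[pi (x i) v, w] = d) -> '[u, w] = d.
  move=> xw; apply: (uP _ _ 0) => N.
  rewrite linear_sumlz/= (eq_bigr (fun=> d)) => [|i _]; last exact: xw.
  by rewrite sumr_const card_ord mulr_natl subrr normr0 expr0n mulr0.
have uorb (y : Isom U) : fix_ C y -> '[u, pi y v] = c.
  move=> yC; apply: (uP _ _ (2 * ('[v, v] - c) * '[v, v])) => N.
  (* the maximum of delta and of the distances from y a to the first N points
     of the clique *)
  have [s [Ds ds sC sN]] : exists s, [/\ Delta s, delta <= s,
      forall e, C e -> s <= 2 * mdist a e
      & forall i, (i < N)%N -> mdist (x i a) (y a) <= s].
    elim: N => [|N [s [Ds ds sC sN]]].
      exists delta; split=> // e Ce.
      by rewrite (le_trans (deltaC Ce))// ler_peMl ?mdist_ge0// ler1n.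
    have [sx|xs] := leP (mdist (x N a) (y a)) s.
      exists s; split=> // i; rewrite ltnS leq_eqVlt => /predU1P[->//|].
      exact: sN.
    exists (mdist (x N a) (y a)); split.
    - exact: valU.
    - exact: le_trans ds (ltW xs).
    - by move=> e Ce; exact: orbit_dist_le.
    - move=> i; rewrite ltnS leq_eqVlt => /predU1P[->//|iN].
      exact: le_trans (sN _ iN) (ltW xs).
  apply: (clique_average_bound cdelta _ cr xcl yC Ds ds sC).
    exact: constant_at_all.
  move=> i iN; apply: le_trans (sN _ iN) _.
  by rewrite ler_peMl ?ler1n// (le_trans _ ds)// ltW.
have ufix g : fix_ C g -> '[u, pi g u - u] = 0.
  move=> gC; apply: uavg => i.
  rewrite linearBr/= innerC [X in _ - X]innerC uorb// rep_inner -repM uorb.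
    by rewrite subrr.
  exact: fixator_mul (fixator_inv gC) (xC i).
exists u => // g gC; apply/eqP; rewrite -subr_eq0 -(dnorm_eq0 (@inner R H)).
rewrite {1}linearBl/= ufix// subr0 linearBr/= unitary_inner rep_inner.
by rewrite -linearBr/= -opprB linearNr/= ufix ?oppr0//; exact: fixator_inv.
Qed.

End OnePoint.

(** * Removing the points of A outside B *)

Section Peeling.
Variable Delta : set R.
Hypotheses (DD : distance_set Delta) (uryU : is_urysohn Delta U).

(** The point b supplies a positive distance when s is empty. *)
Lemma separated_lower_bound a b (s : seq U) : b != a -> a \notin s ->
  exists d, [/\ Delta d, 0 < d & forall x, x \in s -> d <= mdist a x].
Proof.
have [_ valU _ _] := uryU.
move=> ba; elim: s => [_|x s IH].
  by exists (mdist a b); split=> //; rewrite mdist_gt0 eq_sym.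
rewrite inE negb_or => /andP[ax /IH[d [Dd d0 ds]]].
have [dx|xd] := leP d (mdist a x).
  by exists d; split=> // y; rewrite inE => /predU1P[->//|/ds].
exists (mdist a x); split=> //; first by rewrite mdist_gt0.
move=> y; rewrite inE => /predU1P[->//|/ds]; exact: le_trans (ltW xd).
Qed.

(** The clique is chosen with the same distances as a to B, so that it is
    obtained from a by isometries fixing B; these do not change inner
    products with vectors fixed by the stabiliser of B. *)
Lemma peel_point (B C : set U) a v : finite_set B -> C `<=` B -> ~ B a ->
  inv_ (a |` C) v ->
  exists2 u, inv_ C u & forall w, inv_ B w -> '[v, w] = '[u, w].
Proof.
move=> finB CB Ba vinv.
have finC : finite_set C := sub_finite_set CB finB.
have homU : ultrahomogeneous U by case: uryU.
have [[b ba]|Ua] := pselect (exists b, b != a); last first.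
  (* U is reduced to a, which every isometry fixes *)
  exists v => // g gC; apply: vinv => x [->|/gC//].
  by apply/eqP/negPn/negP => gaa; apply: Ua; exists (g a).
have /finite_seqP[s sB] := finB.
have aNs : a \notin s by apply/negP => as_; apply: Ba; rewrite sB.
have [d [Dd d0 ds]] := separated_lower_bound ba aNs.
have dB x : B x -> d <= mdist a x by rewrite sB => /ds.
have [|||p [ph pd]] := @urysohn_extension _ _ _ (distance_set0 DD) uryU
    B (mdist a) d finB Dd d0.
- move=> x /dB dx; split; [|exact: lt_le_trans dx|lra].
  by case: uryU.
- move=> x y _ _; rewrite addrC [mdist x y]metric_sym.
  exact: metric_triangle.
- by move=> x y _ _; rewrite [mdist a x]metric_sym; exact: metric_triangle.
have /choice[x xP] : forall i, exists g, fix_ B g /\ g a = p i.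
  move=> i; have [|g gB ga] := @transport _ _ B a (p i) homU finB.
    by move=> e Be; rewrite ph.
  by exists g.
have xcl : clique C a d x.
  split=> [i|i j ij]; first by apply: fixatorS CB _; case: (xP i).
  by have [_ ->] := xP i; have [_ ->] := xP j; exact: pd.
have dC c : C c -> d <= mdist a c by move/CB/dB.
have [u uC uw] := clique_average_fixed DD uryU finC vinv Dd d0 dC xcl.
exists u => // w wB; apply/esym/uw => i.
by rewrite rep_inner wB//; apply: fixator_inv; case: (xP i).
Qed.

(** Remove the points of s one by one.  When a is removed, B is enlarged by
    the points of s that remain, so that its trace on the points of A is what
    should be left. *)
Lemma peel_points (s : seq U) (B C : set U) v : finite_set B -> C `<=` B ->
  (forall x, x \in s -> ~ B x) -> inv_ (C `|` [set` s]) v ->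
  exists2 u, inv_ C u & forall w, inv_ B w -> '[v, w] = '[u, w].
Proof.
move=> finB CB; elim: s v => [|a s IH] v sB.
  by rewrite set_nil setU0 => vC; exists v.
have sB' x : x \in s -> ~ B x by move=> xs; apply: sB; rewrite inE xs orbT.
have -> : [set` a :: s] = a |` [set` s].
  apply/seteqP; split=> x /=; first by rewrite inE => /predU1P.
  by move=> xas; rewrite inE; exact/predU1P.
rewrite setUCA => vinv.
have [as_|aNs] := boolP (a \in s).
  apply: IH => //; suff <- : a |` (C `|` [set` s]) = C `|` [set` s] by [].
  by apply: setUidr => x ->; right.
have [||||u' u'inv u'w] := @peel_point (B `|` [set` s]) (C `|` [set` s]) a v.
- by rewrite finite_setU; split.
- exact: setSU.
- by case=> [|/(negP aNs)//]; apply: sB; rewrite mem_head.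
- exact: vinv.
have [u uC uw] := IH _ sB' u'inv; exists u => // w wB.
rewrite u'w ?uw// => g gB; apply: wB; apply: fixatorS gB.
by move=> x Bx; left.
Qed.

End Peeling.
End Representation.

Theorem theorem4p12 (R : realType) (Delta : set R) (U : metricType R)
    (H : hilbertType R) (pi : {multiplicative Isom U -> unitary H}) :
  distance_set Delta -> is_urysohn Delta U ->
  continuous (pi : Isom U -> unitary H) ->
  dissociated (@isom_fun R U) pi.
Proof.
move=> DD uryU _ A B finA finB v w [vA vC] [wB wC].
have /finite_seqP[s sAB] : finite_set (A `\` B) by exact: finite_setD.
have [|||u uC uw] :=
    @peel_points R U H pi Delta DD uryU s B (A `&` B) v finB.
- by move=> x [].
- by move=> x xs; have : [set` s] x by []; rewrite -sAB => -[].
- by rewrite -sAB setUIDK.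
have uB : invariant_vectors (@isom_fun R U) pi B u.
  by move=> g gB; apply: uC; apply: fixatorS gB => x [].
by rewrite uw// wC.
Qed.
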